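(* Let $P$ be a poset and let $M$ be any $P$-module. Regardless of whether $\mathrm{Int}(P)$ is locally finite, the following are equivalent: (i) $\mathrm{rk}_M^{\mathrm{Int}}$ is Möbius invertible. (ii) $\mathrm{rk}_M^{\mathrm{Int}}$ admits a rank decomposition. (iii) $\mathrm{rk}_M^{\mathrm{Int}}$ admits a unique minimal rank decomposition. (iv) There exists a unique minimal $\mathcal I\subset \mathrm{Int}(P)$ over which $\mathrm{rk}_M^{\mathrm{Int}}$ is Möbius invertible. (v) There exists a unique function $d_M:\mathrm{Int}(P)\to\mathbb Z$ such that for all $I\in\mathrm{Int}(P)$ the set $\{J\in \mathrm{Int}(P): J\supset I,\ d_M(J)\neq 0\}$ is finite and $$\mathrm{rk}_M^{\mathrm{Int}}(I)=\sum_{\substack{J\supset I\\ J\in \mathrm{Int}(P)}} d_M(J).$$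
   Context: Fix a field $k$; $\mathbf{vec}$ is the category of finite-dimensional $k$-vector spaces. A poset $P$ is regarded as a category (a unique morphism $p\to q$ iff $p\le q$). A $P$-module is a functor $M:P\to\mathbf{vec}$, with $M_p:=M(p)$ and $\varphi_M(p,q):=M(p\le q)$. An interval of $P$ is a nonempty $I\subset P$ that is convex ($p,r\in I$, $p\le q\le r$ imply $q\in I$) and connected (any two elements of $I$ are joined by a finite sequence in $I$ whose consecutive elements are comparable). $\mathrm{Int}(P)$ is the set of intervals of $P$. For an interval $I$, the interval module $k_I$ is $k$ on $I$, $0$ elsewhere, with identity maps between points of $I$ and zero maps otherwise. For a connected poset $P$ and a $P$-module $M$, $\mathrm{rk}(M)$ is the rank of the canonical map $\varprojlim M\to\varinjlim M$, namely $i_p\circ\pi_p$ for any $p\in P$ ($\pi_p:\varprojlim M\to M_p$, $i_p:M_p\to\varinjlim M$ the structure maps). The Int-GRI (generalized rank invariant over intervals) of $M$ is $\mathrm{rk}_M^{\mathrm{Int}}:\mathrm{Int}(P)\to\mathbb Z_{\ge0}$, $I\mapsto \mathrm{rk}(M|_I)$. Möbius invertibility: $\mathrm{rk}_M^{\mathrm{Int}}$ is Möbius invertible over $\mathcal I\subset\mathrm{Int}(P)$ if there is a map $d:\mathcal I\to\mathbb Z$ such that for every $I\in\mathrm{Int}(P)$, $\mathrm{rk}_M^{\mathrm{Int}}(I)=\sum_{J\supset I,\,J\in\mathcal I} d(J)$, where the sum has only finitely many nonzero summands. It is Möbius invertible if it is Möbius invertible over some $\mathcal I\subset \mathrm{Int}(P)$.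 Rank decomposition: a multiset $\mathcal R$ of intervals of $P$ is pointwisely finite if for all $p\in P$ the total multiplicity in $\mathcal R$ of intervals containing $p$ is finite; then put $k_{\mathcal R}:=\bigoplus_{R\in\mathcal R}k_R$. A rank decomposition of $\mathrm{rk}_M^{\mathrm{Int}}$ is a pair $(\mathcal R,\mathcal S)$ of pointwisely finite multisets of intervals of $P$ with $\mathrm{rk}_M^{\mathrm{Int}}=\mathrm{rk}_{k_{\mathcal R}}^{\mathrm{Int}}-\mathrm{rk}_{k_{\mathcal S}}^{\mathrm{Int}}$. It is minimal if $\mathcal R$ and $\mathcal S$ are disjoint. $\mathrm{Int}(P)$ is ordered by containment $\supset$; a poset is locally finite if every segment $\{x: p\le x\le q\}$ is finite. *)

(* Defs.v *)
From HB Require Import structures.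
From mathcomp Require Import all_boot all_order all_algebra finmap.
From mathcomp Require Import generic_quotient ring_quotient.
From mathcomp Require Import mathcomp_extra boolp classical_sets functions.
From mathcomp Require Import cardinality fsbigop.

Set Implicit Arguments.
Unset Strict Implicit.
Unset Printing Implicit Defensive.

Import Order.TTheory GRing.Theory.

Local Open Scope classical_set_scope.
Local Open Scope ring_scope.

(* Limits and colimits over infinite posets need not be finite-dimensional, so
   they are built as lmodType's and not as vectType's. *)

Section DirectProduct.
Context {k : fieldType} {J : Type}.
Implicit Types V : J -> lmodType k.

Definition dprod V : Type := forall j, V j.
Identity Coercion dprod_apply : dprod >-> Funclass.

HB.instance Definition _ V := Choice.copy (dprod V) (forall j, V j).

Section Structure.
Variable V : J -> lmodType k.
Implicit Types x y z : dprod V.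

Definition dprod_zero : dprod V := fun=> 0.
Definition dprod_opp x : dprod V := fun j => - x j.
Definition dprod_add x y : dprod V := fun j => x j + y j.
Definition dprod_scale (a : k) x : dprod V := fun j => a *: x j.

Fact dprod_addA : associative dprod_add.
Proof. by move=> x y z; apply: functional_extensionality_dep => j; apply: addrA. Qed.
Fact dprod_addC : commutative dprod_add.
Proof. by move=> x y; apply: functional_extensionality_dep => j; apply: addrC. Qed.
Fact dprod_add0 : left_id dprod_zero dprod_add.
Proof. by move=> x; apply: functional_extensionality_dep => j; apply: add0r. Qed.
Fact dprod_addN : left_inverse dprod_zero dprod_opp dprod_add.
Proof. by move=> x; apply: functional_extensionality_dep => j; apply: addNr. Qed.

HB.instance Definition _ :=
  GRing.isZmodule.Build (dprod V) dprod_addA dprod_addC dprod_add0 dprod_addN.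

Fact dprod_scaleA a b x : dprod_scale a (dprod_scale b x) = dprod_scale (a * b) x.
Proof. by apply: functional_extensionality_dep => j; apply: scalerA. Qed.
Fact dprod_scale1 : left_id 1 dprod_scale.
Proof. by move=> x; apply: functional_extensionality_dep => j; apply: scale1r. Qed.
Fact dprod_scaleDr : right_distributive dprod_scale +%R.
Proof. by move=> a x y; apply: functional_extensionality_dep => j; apply: scalerDr. Qed.
Fact dprod_scaleDl x : {morph dprod_scale^~ x : a b / a + b}.
Proof. by move=> a b; apply: functional_extensionality_dep => j; apply: scalerDl. Qed.

HB.instance Definition _ := GRing.Zmodule_isLmodule.Build k (dprod V)
  dprod_scaleA dprod_scale1 dprod_scaleDr dprod_scaleDl.

End Structure.
End DirectProduct.

Section DirectSum.
Context {k : fieldType} {J : Type}.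
Variable V : J -> lmodType k.

Definition finsupp_pred : {pred dprod V} :=
  [pred x : dprod V | `[< finite_set [set j | x j != 0] >]].

Fact finsupp_submod_closed : subsemimod_closed finsupp_pred.
Proof.
split; first split.
- apply/asboolP; rewrite [X in finite_set X](_ : _ = set0) ?finite_set0 //.
  by rewrite -subset0 => j /=; rewrite eqxx.
- move=> x y /asboolP fx /asboolP fy; apply/asboolP.
  apply: (sub_finite_set _ (_ : finite_set (_ `|` _))); last first.
    by rewrite finite_setU; split; [exact: fx|exact: fy].
  move=> j /= xyj; have [xj0|xj] := eqVneq (x j) 0; [right|by left].
  by apply: contra_neq xyj => yj0; rewrite /GRing.add/= /dprod_add xj0 yj0 addr0.
- move=> a x /asboolP fx; apply/asboolP; apply: sub_finite_set fx => j /=.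
  by apply: contra_neq => xj0; rewrite /GRing.scale/= /dprod_scale xj0 scaler0.
Qed.

HB.instance Definition _ :=
  GRing.isSubmodClosed.Build k (dprod V) finsupp_pred finsupp_submod_closed.

Record dsum : Type := DSum {
  dsum_val :> dprod V;
  dsum_valP : dsum_val \in finsupp_pred }.

HB.instance Definition _ := [isSub for dsum_val].
HB.instance Definition _ := [Choice of dsum by <:].
HB.instance Definition _ := [SubChoice_isSubLmodule of dsum by <:].

End DirectSum.
Arguments finsupp_pred {k J} V.

Section DirectSumInclusion.
Context {k : fieldType} {J : eqType} {V : J -> lmodType k}.

Fact dsum_in_subproof i (v : V i) :
  (eqtype.dfwith (fun j => 0 : V j) v : dprod V) \in finsupp_pred V.
Proof.
apply/asboolP; apply: sub_finite_set (finite_set1 i) => j /=.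
by case: eqtype.dfwithP => // j' _; rewrite eqxx.
Qed.

Definition dsum_in i (v : V i) : dsum V := DSum (dsum_in_subproof v).

Fact dsum_in_linear i : linear (@dsum_in i).
Proof.
move=> a u v; apply: val_inj; apply: functional_extensionality_dep => j.
rewrite linearP /= [RHS]/GRing.add /= /dprod_add [X in _ = X + _]/GRing.scale /=.
rewrite /dprod_scale; have [<-|ij] := eqVneq i j; first by rewrite !eqtype.dfwith_in.
by rewrite !eqtype.dfwith_out // scaler0 addr0.
Qed.

HB.instance Definition _ i :=
  GRing.isLinear.Build k (V i) (dsum V) _ (@dsum_in i) (@dsum_in_linear i).

End DirectSumInclusion.

Section DirectSumMap.
Context {k : fieldType} {J : Type} {V W : J -> lmodType k}.
Variable f : forall j, {linear V j -> W j}.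

Fact dsum_map_subproof (x : dsum V) :
  ((fun j => f j (x j)) : dprod W) \in finsupp_pred W.
Proof.
have /asboolP := dsum_valP x; move=> fx; apply/asboolP.
apply: sub_finite_set fx => j /=; apply: contra_neq => ->; exact: linear0.
Qed.

Definition dsum_map (x : dsum V) : dsum W := DSum (dsum_map_subproof x).

Fact dsum_map_linear : linear dsum_map.
Proof.
move=> a x y; apply: val_inj; apply: functional_extensionality_dep => j.
rewrite linearP /=; exact: linearP.
Qed.

HB.instance Definition _ :=
  GRing.isLinear.Build k (dsum V) (dsum W) _ dsum_map dsum_map_linear.

End DirectSumMap.

Section DirectSumVect.
Context {k : fieldType} {J : choiceType} (V : J -> vectType k).
Hypothesis finV : finite_set [set j | exists x : V j, x != 0].

Let D : {fset J} := fset_set [set j | exists x : V j, x != 0].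
Let T : finType := {j : D & 'I_(\dim {: V (val j)})}.

Let mem_D j (v : V j) : v != 0 -> j \in D.
Proof. by move=> v0; rewrite in_fset_set // inE; exists v. Qed.

Let to_rV (x : dsum V) : 'rV[k]_#|T| :=
  \row_t coord (vbasis {: V (val (tag (enum_val t)))}) (tagged (enum_val t))
               (x (val (tag (enum_val t)))).

Let of_rV (r : 'rV[k]_#|T|) : dsum V :=
  \sum_t r ord0 t *: dsum_in (vbasis {: V (val (tag (enum_val t)))})`_(tagged (enum_val t)).

Let to_rV_linear : linear to_rV.
Proof.
move=> a x y; apply/rowP => t; rewrite !mxE -linearP; congr coord.
Qed.

Let to_rV_eq0 (x : dsum V) : to_rV x = 0 -> x = 0.
Proof.
move=> /rowP x0; apply: val_inj; apply: functional_extensionality_dep => j /=.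
apply/eqP; apply/negPn/negP => xj; have jD := mem_D xj.
move: xj; rewrite (coord_vbasis (memvf (x j))) big1 ?eqxx // => i _.
have := x0 (enum_rank (Tagged (fun j : D => 'I_(\dim {: V (val j)}))
                            (i : 'I_(\dim {: V (val [` jD]%fset)})))).
by rewrite !mxE enum_rankK /= => ->; rewrite scale0r.
Qed.

Let of_rVK : cancel of_rV to_rV.
Proof.
move=> r; apply/rowP => t.
pose L := GRing.isLinear.Build k (dsum V) 'rV[k]_#|T| _ to_rV to_rV_linear.
pose toL : {linear dsum V -> 'rV[k]_#|T|} := HB.pack to_rV L.
have toE s :
    toL (r ord0 s *: dsum_in (vbasis {: V (val (tag (enum_val s)))})`_(tagged (enum_val s)))
    ord0 t = r ord0 s * (s == t)%:R.
  rewrite linearZ !mxE; congr (_ * _) => /=; rewrite -(inj_eq enum_val_inj).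
  move: (enum_val s) (enum_val t) => [j i] [j' i'] /=.
  have [e|nj] := eqVneq j j'.
    case: j' / e i' => i'; rewrite eqtype.dfwith_in -tag_eqE /tag_eq /= eqxx tagged_asE.
    by rewrite coord_free ?(basis_free (vbasisP _)).
  rewrite eqtype.dfwith_out ?(inj_eq val_inj) // linear0 -tag_eqE /tag_eq /=.
  by rewrite (negPf nj).
rewrite -[to_rV]/(toL : _ -> _) linear_sum summxE (bigD1 t) //= toE eqxx mulr1.
rewrite big1 ?addr0 // => s st.
by rewrite toE (negPf st) mulr0.
Qed.

Let dsum_finDim : Vector.axiom #|T| (dsum V).
Proof.
exists to_rV; first exact: to_rV_linear.
exists of_rV => [x|]; last exact: of_rVK.
apply/eqP; rewrite -subr_eq0; apply/eqP; apply: to_rV_eq0.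
by rewrite addrC -scaleN1r to_rV_linear of_rVK scaleN1r addNr.
Qed.

Definition dsum_vect : vectType k :=
  HB.pack (dsum V) (Lmodule_hasFinDim.Build k (dsum V) dsum_finDim).

End DirectSumVect.

Section Quotient.
Context {k : fieldType} {V : lmodType k}.
Implicit Types A : set V.

Definition lin_span A : {pred V} := [pred x | `[<
  exists2 s : seq (k * V), (forall cv, cv \in s -> A cv.2) &
    x = \sum_(cv <- s) cv.1 *: cv.2 >]].

Fact span_submod_closed A : subsemimod_closed (lin_span A).
Proof.
split; first split.
- by apply/asboolP; exists [::]; rewrite ?big_nil.
- move=> _ _ /asboolP[s As ->] /asboolP[t At ->]; apply/asboolP.
  exists (s ++ t); rewrite ?big_cat // => cv.
  by rewrite mem_cat => /orP[/As|/At].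
- move=> a _ /asboolP[s As ->]; apply/asboolP.
  exists [seq (a * cv.1, cv.2) | cv <- s].
    by move=> _ /mapP[cv /As Acv ->].
  by rewrite big_map scaler_sumr; apply: eq_bigr => cv _; rewrite scalerA.
Qed.

HB.instance Definition _ A :=
  GRing.isSubmodClosed.Build k V (lin_span A) (@span_submod_closed A).

Section QuotientStructure.
Variable A : set V.

Definition quot_span : Type := Quotient.quot (lin_span A).

HB.instance Definition _ := GRing.Zmodule.on quot_span.

Definition quot_pi (x : V) : quot_span := (\pi_(Quotient.quot (lin_span A)) x)%qT.

Fact quot_piE x y : quot_pi x = quot_pi y <-> x - y \in lin_span A.
Proof. by split=> [/eqP|] xy; [|apply/eqP]; move: xy; rewrite Quotient.idealrBE. Qed.

Fact quot_pi_zmod_morphism : zmod_morphism quot_pi.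
Proof. exact: raddfB. Qed.

HB.instance Definition _ :=
  GRing.isZmodMorphism.Build V quot_span quot_pi quot_pi_zmod_morphism.

Fact quot_pi_surj (u : quot_span) : exists x, u = quot_pi x.
Proof. by exists (repr (u : Quotient.quot (lin_span A))); rewrite /quot_pi reprK. Qed.

Definition quot_scale (a : k) (u : quot_span) : quot_span :=
  quot_pi (a *: repr (u : Quotient.quot (lin_span A))).

Fact quot_scale_pi a x : quot_scale a (quot_pi x) = quot_pi (a *: x).
Proof.
apply/quot_piE; rewrite -scalerBr; apply: rpredZ; apply/quot_piE.
by rewrite /quot_pi reprK.
Qed.

Fact quot_scaleA a b u : quot_scale a (quot_scale b u) = quot_scale (a * b) u.
Proof. by have [x ->] := quot_pi_surj u; rewrite !quot_scale_pi scalerA. Qed.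
Fact quot_scale1 : left_id 1 quot_scale.
Proof. by move=> u; have [x ->] := quot_pi_surj u; rewrite quot_scale_pi scale1r. Qed.
Fact quot_scaleDr : right_distributive quot_scale +%R.
Proof.
move=> a u v; have [x ->] := quot_pi_surj u; have [y ->] := quot_pi_surj v.
by rewrite -raddfD !quot_scale_pi -raddfD scalerDr.
Qed.
Fact quot_scaleDl u : {morph quot_scale^~ u : a b / a + b}.
Proof.
by move=> a b; have [x ->] := quot_pi_surj u; rewrite !quot_scale_pi scalerDl raddfD.
Qed.

HB.instance Definition _ := GRing.Zmodule_isLmodule.Build k quot_span
  quot_scaleA quot_scale1 quot_scaleDr quot_scaleDl.

Fact quot_pi_scalable : scalable quot_pi.
Proof. by move=> a x; rewrite -quot_scale_pi. Qed.

HB.instance Definition _ :=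
  GRing.isScalable.Build k V quot_span _ quot_pi quot_pi_scalable.

End QuotientStructure.
End Quotient.

Section Rank.
Context {k : fieldType} {U V : lmodType k}.

Definition is_rank (f : U -> V) (n : nat) : Prop :=
  exists b : 'I_n -> V,
    [/\ forall i, exists u, f u = b i,
        forall c : 'I_n -> k, \sum_i c i *: b i = 0 -> forall i, c i = 0
      & forall u, exists c : 'I_n -> k, f u = \sum_i c i *: b i].

(* The dimension of the range of f, by convention 0 when that dimension is
   infinite, which does not occur for the canonical maps below. *)
Definition lin_rank (f : {linear U -> V}) : nat := xget 0%N [set n | is_rank f n].

End Rank.

Record pmodule (k : fieldType) (d : Order.disp_t) (P : porderType d) := PModule {
  pm_obj :> P -> vectType k;
  pm_map : forall p q : P, (p <= q)%O -> 'Hom(pm_obj p, pm_obj q);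
  pm_map_id : forall (p : P) (pp : (p <= p)%O), pm_map pp = \1%VF;
  pm_map_comp : forall (p q r : P) (pq : (p <= q)%O) (qr : (q <= r)%O) (pr : (p <= r)%O),
    pm_map pr = (pm_map qr \o pm_map pq)%VF }.

Section LimitColimit.
Context {k : fieldType} {d : Order.disp_t} {P : porderType d}.
Variable M : pmodule k P.

Definition lim_pred : {pred dprod (pm_obj M)} :=
  [pred x : dprod (pm_obj M) | `[< forall (p q : P) (pq : (p <= q)%O), pm_map M pq (x p) = x q >]].

Fact lim_submod_closed : subsemimod_closed lim_pred.
Proof.
split; first split.
- by apply/asboolP => p q pq; apply: linear0.
- move=> x y /asboolP Mx /asboolP My; apply/asboolP => p q pq.
  by rewrite [LHS]linearD; congr (_ + _); [apply: Mx|apply: My].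
- move=> a x /asboolP Mx; apply/asboolP => p q pq.
  by rewrite [LHS]linearZ; congr (_ *: _); apply: Mx.
Qed.

HB.instance Definition _ :=
  GRing.isSubmodClosed.Build k (dprod (pm_obj M)) lim_pred lim_submod_closed.

Record plim : Type := PLim { plim_val :> dprod (pm_obj M); plim_valP : plim_val \in lim_pred }.

HB.instance Definition _ := [isSub for plim_val].
HB.instance Definition _ := [Choice of plim by <:].
HB.instance Definition _ := [SubChoice_isSubLmodule of plim by <:].

Definition lim_proj (p : P) (x : plim) : M p := x p.

Fact lim_proj_linear p : linear (lim_proj p).
Proof. by []. Qed.

HB.instance Definition _ p :=
  GRing.isLinear.Build k plim (M p) _ (lim_proj p) (lim_proj_linear p).

Definition colim_rel : set (dsum (pm_obj M)) := [set x |
  exists (p q : P) (pq : (p <= q)%O) (v : M p),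
  x = dsum_in (V := pm_obj M) (pm_map M pq v) - dsum_in (V := pm_obj M) v].

Definition pcolim : Type := quot_span colim_rel.

HB.instance Definition _ := GRing.Lmodule.on pcolim.

Definition colim_inj (p : P) (v : M p) : pcolim := quot_pi colim_rel (dsum_in (V := pm_obj M) v).

Fact colim_inj_linear p : linear (@colim_inj p).
Proof. by move=> a u v; rewrite /colim_inj !linearP. Qed.

HB.instance Definition _ p :=
  GRing.isLinear.Build k (M p) pcolim _ (@colim_inj p) (@colim_inj_linear p).

Definition lim_to_colim_at (p : P) : {linear plim -> pcolim} :=
  (@colim_inj p \o lim_proj p).

End LimitColimit.

Lemma lim_to_colim_at_comparable (k : fieldType) (d : Order.disp_t)
    (P : porderType d) (M : pmodule k P) (p q : P) :
  (p >=< q)%O -> lim_to_colim_at M p =1 lim_to_colim_at M q.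
Proof.
wlog pq : p q / (p <= q)%O => [th|_ x].
  by move=> /orP[] pq x; [|symmetry]; apply: th; rewrite // /Order.comparable pq.
symmetry; apply/quot_piE/asboolP.
exists [:: (1, dsum_in (V := pm_obj M) (val x q) - dsum_in (V := pm_obj M) (val x p))].
  move=> _ /[1!inE] /eqP ->; exists p, q, pq, (val x p).
  by have /asboolP -> := plim_valP x.
by rewrite big_seq1 scale1r.
Qed.

Section Restriction.
Context {k : fieldType} {d : Order.disp_t} {P : porderType d}.

Record subposet (A : set P) : Type := SubPoset { sp_val :> P; sp_valP : sp_val \in A }.

HB.instance Definition _ A := [isSub for @sp_val A].
HB.instance Definition _ A := [Choice of subposet A by <:].
HB.instance Definition _ A := [SubChoice_isSubPOrder of subposet A by <: with d].

Variables (M : pmodule k P) (A : set P).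

Definition restrict_map (p q : subposet A) (pq : (p <= q)%O) : 'Hom(M p, M q) :=
  pm_map M (Order.SubPreorderTheory.le_wval _ _ pq).

Fact restrict_map_id p (pp : (p <= p)%O) : restrict_map pp = \1%VF.
Proof. exact: pm_map_id. Qed.

Fact restrict_map_comp p q r (pq : (p <= q)%O) (qr : (q <= r)%O) (pr : (p <= r)%O) :
  restrict_map pr = (restrict_map qr \o restrict_map pq)%VF.
Proof. exact: pm_map_comp. Qed.

Definition restrict : pmodule k (subposet A) :=
  PModule restrict_map_id restrict_map_comp.

End Restriction.

Record Int (d : Order.disp_t) (P : porderType d) : Type := MkInt {
  int_set :> set P;
  int_nonempty : int_set !=set0;
  int_convex : forall p q r : P,
    int_set p -> int_set r -> (p <= q)%O -> (q <= r)%O -> int_set q;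
  int_connected : forall p q : P, int_set p -> int_set q ->
    exists s : seq P, [/\ forall x, x \in s -> int_set x,
      path (fun x y => x >=< y)%O p s & last p s = q] }.

HB.instance Definition _ d (P : porderType d) := gen_eqMixin (Int P).
HB.instance Definition _ d (P : porderType d) := gen_choiceMixin (Int P).

Lemma int_set_inj d (P : porderType d) : injective (@int_set d P).
Proof.
case=> [A n c t] [B n' c' t'] /= AB; case: _ / AB in n' c' t' *.
by congr MkInt; apply: Prop_irrelevance.
Qed.

Section GRI.
Context {k : fieldType} {d : Order.disp_t} {P : porderType d}.
Implicit Types (M : pmodule k P) (I : Int P).

Definition int_base I : subposet I :=
  let: exist p Ip := cid (int_nonempty I) in SubPoset (mem_set Ip).

(* The canonical map is the same at every point, so the choice of int_base is
   immaterial. *)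
Lemma lim_to_colim_at_interval M I (p q : subposet I) :
  lim_to_colim_at (restrict M I) p =1 lim_to_colim_at (restrict M I) q.
Proof.
have [s [sI ps lq]] := int_connected (set_mem (sp_valP p)) (set_mem (sp_valP q)).
elim: s p sI ps lq => [|r s IHs] p sI /=; first by move=> _ /val_inj ->.
move=> /andP[pr rs] lq x; have Ir : r \in (I : set P) by apply/mem_set/sI/mem_head.
rewrite (@lim_to_colim_at_comparable _ _ _ _ p (SubPoset Ir)) //.
by apply: IHs => // y ys; apply: sI; rewrite inE ys orbT.
Qed.

Definition gri M I : nat := lin_rank (lim_to_colim_at (restrict M I) (int_base I)).

End GRI.

Section IntervalModule.
Context {k : fieldType} {d : Order.disp_t} {P : porderType d}.
Variable I : Int P.

(* k^1 at the points of I and k^0 elsewhere; pid_mx 1 is the identity between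
   points of I, and all other matrices have no rows or no columns. *)
Definition kint_obj (p : P) : vectType k := 'rV[k]_(p \in (I : set P)).

Definition kint_map (p q : P) (pq : (p <= q)%O) : 'Hom(kint_obj p, kint_obj q) :=
  linfun (mulmxr (pid_mx 1) : kint_obj p -> kint_obj q).

Fact kint_map_id p (pp : (p <= p)%O) : kint_map pp = \1%VF.
Proof.
apply/lfunP => v; rewrite id_lfunE lfunE /=.
move: v; rewrite /kint_obj; case: (p \in _) => v /=; last by rewrite [LHS]thinmx0 [RHS]thinmx0.
by rewrite pid_mx_1 mulmx1.
Qed.

Fact kint_map_comp p q r (pq : (p <= q)%O) (qr : (q <= r)%O) (pr : (p <= r)%O) :
  kint_map pr = (kint_map qr \o kint_map pq)%VF.
Proof.
apply/lfunP => v; rewrite comp_lfunE !lfunE /= -mulmxA; congr (_ *m _).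
have : p \in (I : set P) -> r \in (I : set P) -> q \in (I : set P).
  by move=> /set_mem Ip /set_mem Ir; apply/mem_set; apply: int_convex Ip Ir _ _.
case: (p \in _); last by move=> _; rewrite [LHS]flatmx0 [RHS]flatmx0.
case: (r \in _) => [->//|_]; last by rewrite [LHS]thinmx0 [RHS]thinmx0.
by rewrite !pid_mx_1 mulmx1.
Qed.

Definition kint : pmodule k P := PModule kint_map_id kint_map_comp.

End IntervalModule.

Section DirectSumModule.
Context {k : fieldType} {d : Order.disp_t} {P : porderType d} {J : choiceType}.
Variable M : J -> pmodule k P.
Hypothesis finM : forall p : P, finite_set [set j | exists x : M j p, x != 0].

Definition pm_dsum_obj (p : P) : vectType k := dsum_vect (finM p).

Definition pm_dsum_map (p q : P) (pq : (p <= q)%O) :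
    'Hom(pm_dsum_obj p, pm_dsum_obj q) :=
  linfun (dsum_map (fun j => pm_map (M j) pq) : pm_dsum_obj p -> pm_dsum_obj q).

Fact pm_dsum_mapE p q (pq : (p <= q)%O) (v : pm_dsum_obj p) :
  pm_dsum_map pq v = dsum_map (fun j => pm_map (M j) pq) v.
Proof. exact: lfunE. Qed.

Fact pm_dsum_map_id p (pp : (p <= p)%O) : pm_dsum_map pp = \1%VF.
Proof.
apply/lfunP => v; rewrite id_lfunE pm_dsum_mapE; apply: val_inj.
apply: functional_extensionality_dep => j /=.
by rewrite pm_map_id id_lfunE.
Qed.

Fact pm_dsum_map_comp p q r (pq : (p <= q)%O) (qr : (q <= r)%O) (pr : (p <= r)%O) :
  pm_dsum_map pr = (pm_dsum_map qr \o pm_dsum_map pq)%VF.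
Proof.
apply/lfunP => v; rewrite comp_lfunE !pm_dsum_mapE; apply: val_inj.
apply: functional_extensionality_dep => j /=.
by rewrite (pm_map_comp (M j) pq qr pr) comp_lfunE.
Qed.

Definition pm_dsum : pmodule k P := PModule pm_dsum_map_id pm_dsum_map_comp.

End DirectSumModule.

(* A multiset of intervals is given by its multiplicity function; as intervals
   are nonempty, pointwise finiteness forces the multiplicities to be finite. *)
Record pf_multiset (d : Order.disp_t) (P : porderType d) : Type := PfMultiset {
  mult :> Int P -> nat;
  mult_finite : forall p : P, finite_set [set R : Int P | int_set R p /\ mult R != 0%N] }.

Section MultisetModule.
Context (k : fieldType) {d : Order.disp_t} {P : porderType d}.
Variable m : pf_multiset P.

(* The members of m, each repeated according to its multiplicity. *)
Definition mult_index : choiceType := {R : Int P & 'I_(m R)}.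

Fact kmult_finite (p : P) :
  finite_set [set j : mult_index | exists x : kint (k := k) (tag j) p, x != 0].
Proof.
have -> : [set j : mult_index | exists x : kint (k := k) (tag j) p, x != 0] =
    \bigcup_(R in [set R : Int P | int_set R p /\ m R != 0%N])
      (fun i : 'I_(m R) => Tagged (fun R : Int P => 'I_(m R)) i) @` setT.
  apply/seteqP; split=> [[R i] /= [x x0]|_ [R [Rp _] [i _ <-]]] /=.
    exists R; last by exists i.
    split; last by rewrite -lt0n (leq_ltn_trans _ (ltn_ord i)).
    apply: contrapT => Rp; move: x x0; rewrite /kint_obj memNset // => x.
    by rewrite [x]thinmx0 eqxx.
  rewrite /kint_obj mem_set //; exists (const_mx 1).
  by apply/eqP => /matrixP/(_ ord0 ord0)/eqP; rewrite !mxE oner_eq0.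
apply: bigcup_finite; first exact: mult_finite.
by move=> R _; apply: finite_image; apply: finite_finset.
Qed.

Definition kmult : pmodule k P := pm_dsum kmult_finite.

End MultisetModule.

Section RankDecomposition.
Context {k : fieldType} {d : Order.disp_t} {P : porderType d}.
Variable M : pmodule k P.
Implicit Types (R S : pf_multiset P) (X : set (Int P)).

Definition mobius_invertible_over X : Prop :=
  exists dX : X -> int, forall I : Int P,
    finite_set [set J : X | I `<=` val J /\ dX J != 0] /\
    (gri M I)%:Z = \sum_(J \in [set J : X | I `<=` val J]) dX J.

Definition mobius_invertible : Prop := exists X, mobius_invertible_over X.

Definition minimal_mobius_domain X : Prop :=
  mobius_invertible_over X /\
  forall Y : set (Int P), Y `<=` X -> mobius_invertible_over Y -> Y = X.

Definition rank_decomposition (RS : pf_multiset P * pf_multiset P) : Prop :=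
  forall I : Int P,
    (gri M I)%:Z = (gri (kmult k RS.1) I)%:Z - (gri (kmult k RS.2) I)%:Z.

Definition minimal_rank_decomposition (RS : pf_multiset P * pf_multiset P) : Prop :=
  rank_decomposition RS /\ forall I : Int P, RS.1 I = 0%N \/ RS.2 I = 0%N.

End RankDecomposition.

(* Main.v *)
(* Two facts drive the equivalences.  A Moebius inverse of a function on the
   intervals is unique, even when Int(P) is not locally finite: if h has finite
   support above every interval and all its upper sums vanish, then an interval
   with h I != 0 that is maximal among the finitely many such intervals above
   it has upper sum h I.  And the rank of a direct sum of interval modules over
   I is the number of summands k_R with I contained in R: those summands give
   independent classes in the colimit, whereas a summand with some q in I
   outside R contributes nothing, since the canonical map can be computed at q.
   Hence rank decompositions (R, S) are the ways to write the Moebius inverse as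
   a difference of multiplicity functions, the minimal one being given by its
   positive and negative parts; finiteness above the singletons {p} is pointwise
   finiteness. *)
Require Import Defs.
From HB Require Import structures.
From mathcomp Require Import all_boot all_order all_algebra finmap.
From mathcomp Require Import mathcomp_extra boolp classical_sets functions.
From mathcomp Require Import cardinality fsbigop.

Set Implicit Arguments.
Unset Strict Implicit.
Unset Printing Implicit Defensive.

Import Order.TTheory GRing.Theory.

Local Open Scope classical_set_scope.
Local Open Scope ring_scope.

(** A sum over a set has the default value 0 when the summand has infinite support there, hence the
    two finiteness hypotheses; all three sums are then taken over the union of the two supports. *)
Lemma fsumr_linear (R : pzRingType) (T : choiceType) (A : set T) (a : R) (f g : T -> R) :
  finite_set [set x | A x /\ f x != 0] -> finite_set [set x | A x /\ g x != 0] ->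
  \sum_(x \in A) (a * f x + g x) = a * \sum_(x \in A) f x + \sum_(x \in A) g x.
Proof.
move=> ff fg.
set S := [set x | A x /\ f x != 0] `|` [set x | A x /\ g x != 0].
have finS : finite_set S by rewrite finite_setU.
have SA : S `<=` A by move=> x [] [].
have out (h : T -> R) : (forall x, f x = 0 -> g x = 0 -> h x = 0) ->
    \sum_(x \in A) h x = \sum_(x <- fset_set S) h x.
  move=> h0; rewrite -fsbig_finite //; apply/esym/fsbig_widen => // x [Ax Sx].
  apply: h0; apply/eqP/negPn/negP => nz; apply: Sx; [by left|by right].
rewrite !out // => [|x -> ->]; last by rewrite mulr0 addr0.
by rewrite big_split mulr_sumr.
Qed.

(** * Uniqueness of Möbius inverses, and their positive and negative parts *)

Section MobiusInverse.
Context {d : Order.disp_t} {P : porderType d}.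
Implicit Types (I J : Int P) (f g h : Int P -> int).

Definition mobius_inverse f g : Prop := forall I,
  finite_set [set J : Int P | I `<=` J /\ g J != 0] /\
  f I = \sum_(J \in [set J : Int P | I `<=` J]) g J.

(** Strong induction on the number of intervals above [I] at which [h] is nonzero. If [h I != 0], a
    strictly larger interval has fewer of them, since [I] is no longer counted; so [h] vanishes
    there and the upper sum at [I] is [h I]. *)
Lemma mobius_inverse_eq0 h : mobius_inverse (fun=> 0) h -> forall I, h I = 0.
Proof.
move=> hh I; pose A J := [set K : Int P | J `<=` K /\ h K != 0].
have finA J : finite_set (A J) by case: (hh J).
have [n] := ubnP #|` fset_set (A I)|; elim: n I => // n IHn I /ltnSE leIn.
apply/eqP/negPn/negP => hI.
have [_] := hh I; rewrite (fsbigE [:: I]) //=; first 1 last.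
- by move=> J /=; rewrite inE => /eqP ->.
- move=> J /= IJ; rewrite inE => JI; apply: IHn; apply: leq_trans leIn.
  have IAI : I \in fset_set (A I) by rewrite in_fset_set // inE; split.
  apply: fproper_ltn_card; rewrite fproperE; apply/andP; split.
    apply/fsubsetP => K; rewrite !in_fset_set // !inE => -[JK hK]; split=> //.
    exact: subset_trans JK.
  apply/negP => /fsubsetP/(_ _ IAI); rewrite in_fset_set // inE => -[JI' _].
  by move/eqP: JI; apply; apply: int_set_inj; apply/seteqP.
rewrite big_mkcond big_seq1 mem_set //= => h0.
by rewrite -h0 eqxx in hI.
Qed.

Lemma mobius_inverseB f1 f2 g1 g2 : mobius_inverse f1 g1 -> mobius_inverse f2 g2 ->
  mobius_inverse (fun I => f1 I - f2 I) (fun I => g1 I - g2 I).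
Proof.
move=> i1 i2 I; have [fin1 ->] := i1 I; have [fin2 ->] := i2 I; split.
  apply: sub_finite_set (_ : finite_set (_ `|` _)); last first.
    by rewrite finite_setU; split; [exact: fin1|exact: fin2].
  move=> J /= [IJ nz]; have [g1J|] := eqVneq (g1 J) 0; [right|by left].
  by split=> //; apply: contra_neq nz => ->; rewrite g1J subr0.
under [RHS]eq_fsbigr do rewrite addrC -mulN1r.
by rewrite fsumr_linear // mulN1r addrC.
Qed.

Lemma mobius_inverse_uniq f g1 g2 : mobius_inverse f g1 -> mobius_inverse f g2 -> g1 = g2.
Proof.
move=> i1 i2; apply/funext => I; apply/eqP; rewrite -subr_eq0; apply/eqP.
move: I; apply: mobius_inverse_eq0.
have -> : (fun=> 0) = (fun I => f I - f I) by apply/funext => I; rewrite subrr.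
exact: mobius_inverseB.
Qed.

Fact int1_connected (p x y : P) : [set p] x -> [set p] y ->
  exists s : seq P, [/\ forall z, z \in s -> [set p] z,
    path (fun x y => x >=< y)%O x s & last x s = y].
Proof. by move=> -> ->; exists [::]. Qed.

Fact int1_convex (p x y z : P) :
  [set p] x -> [set p] z -> (x <= y)%O -> (y <= z)%O -> [set p] y.
Proof. by move=> -> -> py yp; apply/le_anti; rewrite yp. Qed.

Definition int1 (p : P) : Int P :=
  MkInt (ex_intro [set p] p erefl) (@int1_convex p) (@int1_connected p).

Lemma mobius_inverse_pf f g (p : P) :
  mobius_inverse f g -> finite_set [set J : Int P | int_set J p /\ g J != 0].
Proof.
move=> /(_ (int1 p))[fin _]; apply: sub_finite_set fin => J /= [Jp gJ].
by split=> // _ ->.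
Qed.

(** The negative part of [z] is written [posz_part (- z)]. *)
Definition posz_part (z : int) : nat := if 0 <= z then `|z|%N else 0%N.

Lemma posz_partB z : (posz_part z)%:Z - (posz_part (- z))%:Z = z.
Proof. by case: z => [[|n]|n]; rewrite /posz_part /= ?subr0 ?sub0r ?NegzE ?opprK. Qed.

Lemma posz_part_disj z : posz_part z = 0%N \/ posz_part (- z) = 0%N.
Proof. by case: z => [[|n]|n]; [left|right|left]. Qed.

(** Disjoint multiplicities are recovered from their difference; this makes a minimal rank
    decomposition unique. *)
Lemma posz_part_disjB (m n : nat) :
  m = 0%N \/ n = 0%N -> posz_part (m%:Z - n%:Z) = m.
Proof. by case=> ->; rewrite ?subr0 // sub0r; case: n. Qed.

(** Here [e] stands for either signed part; [e 0 = 0] keeps the new support inside that of [g]. *)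
Fact pf_comp_finite f g (e : int -> nat) (p : P) : e 0 = 0%N -> mobius_inverse f g ->
  finite_set [set J : Int P | int_set J p /\ e (g J) != 0%N].
Proof.
move=> e0 /mobius_inverse_pf - /(_ p) fin; apply: sub_finite_set fin => J /= [Jp eg].
by split=> //; apply: contra_neq eg => ->.
Qed.

Lemma pf_multiset_eq (R S : pf_multiset P) : R =1 S -> R = S.
Proof.
case: R S => [R finR] [S finS] /= /funext RS.
by case: _ / RS in finS *; congr PfMultiset; apply: Prop_irrelevance.
Qed.

End MobiusInverse.

(** * Well-definedness of the rank, and independence in colimits *)

Section Rank.
Context {k : fieldType} {U V : lmodType k}.

(** Expressing [b] through [b'] gives an m by n coefficient matrix. A row vector killing it is a
    linear relation among the [b i], so the matrix is row-free. *)
Lemma is_rank_leq (f : U -> V) (m n : nat) : is_rank f m -> is_rank f n -> (m <= n)%N.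
Proof.
move=> [b [bim bfree _]] [b' [_ _ b'gen]].
have /choice[C bC] i : exists c : 'I_n -> k, b i = \sum_j c j *: b' j.
  by have [u <-] := bim i; apply: b'gen.
pose A := \matrix_(i < m, j < n) C i j.
suff /eqP <- : row_free A by apply: rank_leq_col.
rewrite -kermx_eq0; apply/rowV0P => u /sub_kermxP uA0.
apply/rowP => i; rewrite mxE; move: i; apply: bfree.
under eq_bigr do rewrite bC scaler_sumr.
rewrite exchange_big big1 //= => j _.
under eq_bigr do rewrite scalerA.
rewrite -scaler_suml; have /rowP/(_ j) := uA0; rewrite !mxE => uA0j.
rewrite -[RHS](scale0r (b' j)) -[in RHS]uA0j; congr (_ *: _).
by apply: eq_bigr => i _; rewrite mxE.
Qed.

Lemma lin_rank_card (f : {linear U -> V}) (T : finType) (b : T -> V) :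
    (forall t, exists u, f u = b t) ->
    (forall c : T -> k, \sum_t c t *: b t = 0 -> forall t, c t = 0) ->
    (forall u, exists c : T -> k, f u = \sum_t c t *: b t) ->
  lin_rank f = #|T|.
Proof.
move=> bim bfree bgen.
have reind (F : T -> V) : \sum_t F t = \sum_(i < #|T|) F (enum_val i).
  by rewrite (reindex (@enum_val T T)) //; apply: onW_bij; apply: enum_val_bij.
have rankT : is_rank f #|T|.
  exists (b \o enum_val); split=> [i|c c0 i|u]; first exact: bim.
    have := bfree (c \o enum_rank); rewrite reind /=.
    under eq_bigr do rewrite enum_valK.
    by move=> /(_ c0 (enum_val i)); rewrite enum_valK.
  by have [c ->] := bgen u; exists (c \o enum_val); rewrite reind.
apply: xget_unique => // n rankn.
by apply/eqP; rewrite eqn_leq !(is_rank_leq _ rankT, is_rank_leq _ rankn).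
Qed.

End Rank.

(** Compatible functionals form a cocone with vertex [k] and so factor through the colimit; this is
    the test for independence there. *)
Lemma colim_inj_eq0 (k : fieldType) (d : Order.disp_t) (P : porderType d)
    (F : pmodule k P) (phi : forall p, F p -> k) :
    (forall p, scalar (@phi p)) ->
    (forall p q (pq : (p <= q)%O) v, phi q (pm_map F pq v) = phi p v) ->
  forall p (v : F p), colim_inj v = 0 -> phi p v = 0.
Proof.
move=> phi_lin phi_map p v.
have phi0 q : phi q 0 = 0.
  by have := phi_lin q (-1) 0 0; rewrite scaler0 addr0 mulN1r addNr.
(* The induced functional on the direct sum; its sum is finite because [x] has finite support. *)
pose L (x : dsum (pm_obj F)) := \sum_(q \in [set: P]) phi q (x q).
have L_lin : scalar L.
  move=> a x y; rewrite /L -fsumr_linear.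
  - by apply: eq_fsbigr => q _; rewrite -phi_lin.
  - have /asboolP := dsum_valP x; apply: sub_finite_set => q /= [_].
    by apply: contra_neq => ->.
  - have /asboolP := dsum_valP y; apply: sub_finite_set => q /= [_].
    by apply: contra_neq => ->.
have L0 : L 0 = 0 by rewrite /L fsbig1.
have L_in q (w : F q) : L (dsum_in (V := pm_obj F) w) = phi q w.
  rewrite /L (fsbigE [:: q]) //=.
    by rewrite big_mkcond big_seq1 mem_set //= eqtype.dfwith_in.
  by move=> r _; rewrite inE eq_sym => qr; rewrite eqtype.dfwith_out.
(* Once [0] is written as a class, equality in the quotient puts [dsum_in v] in the span of the
   colimit relations, and [L] kills each of these. *)
have -> : 0 = colim_inj (0 : F p) :> pcolim F by rewrite linear0.
move=> /quot_piE/asboolP[s sA]; rewrite linear0 subr0 => vE.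
rewrite -L_in vE; elim: s sA {vE} => [|[a w] s IHs] sA; first by rewrite big_nil.
rewrite big_cons L_lin IHs; last by move=> x xs; apply: sA; rewrite inE xs orbT.
have [q [r [qr [u /= ->]]]] := sA _ (mem_head _ _).
by rewrite [X in L X]addrC -scaleN1r L_lin !L_in phi_map mulN1r addNr mulr0 addr0.
Qed.

(** * Canonical maps of direct sums *)

Section DirectSumLimit.
Context {k : fieldType} {d : Order.disp_t} {P : porderType d} {J : choiceType}.
Variable M : J -> pmodule k P.
Hypothesis finM : forall p : P, finite_set [set j | exists x : M j p, x != 0].
Variable I : Int P.
Let F : pmodule k (subposet I) := Defs.restrict (pm_dsum finM) I.

Lemma dsum_sum_in (V : J -> lmodType k) (D : {fset J}) (x : dsum V) :
  (forall j, x j != 0 -> j \in D) -> x = \sum_(j <- D) dsum_in (x j).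
Proof.
move=> xD; apply: val_inj; apply: functional_extensionality_dep => j.
pose ev (y : dsum V) := y j.
have ev_lin : linear ev by [].
pose ev' : {linear dsum V -> V j} := HB.pack ev (GRing.isLinear.Build k _ _ _ ev ev_lin).
rewrite -[LHS]/(ev' x) -[RHS]/(ev' _) linear_sum /= /ev.
have [jD|jD] := boolP (j \in D).
  rewrite (big_fsetD1 j) //= eqtype.dfwith_in big1_fset ?addr0 // => i.
  by rewrite !inE => /andP[ij _] _; rewrite eqtype.dfwith_out.
rewrite big1_fset => [|i iD _]; last first.
  by rewrite /= eqtype.dfwith_out //; apply: contraNneq jD => <-.
by apply/eqP/negPn/negP => /xD; rewrite (negPf jD).
Qed.

Fact lim_in_subproof j (y : plim (Defs.restrict (M j) I)) :
  ((fun q => dsum_in (V := fun j => M j q) (y q)) : dprod (pm_obj F)) \in lim_pred (M := F).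
Proof.
apply/asboolP => p q pq; rewrite [LHS]pm_dsum_mapE; apply: val_inj.
apply: functional_extensionality_dep => i /=.
have [<-|ij] := eqVneq j i; last by rewrite !eqtype.dfwith_out // linear0.
by rewrite !eqtype.dfwith_in; have /asboolP -> := plim_valP y.
Qed.

Definition lim_in j (y : plim (Defs.restrict (M j) I)) : plim F := PLim (lim_in_subproof y).

Fact lim_comp_subproof j (x : plim F) :
  ((fun q => (x q : dsum _) j) : dprod (pm_obj (Defs.restrict (M j) I))) \in
    lim_pred (M := Defs.restrict (M j) I).
Proof.
apply/asboolP => p q pq; have /asboolP xF := plim_valP x.
by rewrite -(xF _ _ pq) [in RHS]pm_dsum_mapE.
Qed.

Definition lim_comp j (x : plim F) : plim (Defs.restrict (M j) I) :=
  PLim (lim_comp_subproof j x).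

(** A compatible family may have infinitely many nonzero components overall, but the canonical map
    at [p] sees only [x p], which has finitely many. *)
Lemma lim_to_colim_dsum (p : subposet I) (D : {fset J}) (x : plim F) :
    (forall j, (x p : dsum _) j != 0 -> j \in D) ->
  lim_to_colim_at F p x = \sum_(j <- D) lim_to_colim_at F p (lim_in (lim_comp j x)).
Proof.
move=> xD; rewrite /lim_to_colim_at /= /lim_proj.
rewrite -(linear_sum (@colim_inj _ _ _ F p)); congr colim_inj.
exact: (@dsum_sum_in (fun j => M j p) D (x p)).
Qed.

Lemma lim_in_vanish j (p q : subposet I) (y : plim (Defs.restrict (M j) I)) :
  y q = 0 -> lim_to_colim_at F p (lim_in y) = 0.
Proof.
move=> yq0; rewrite (lim_to_colim_at_interval p q) /lim_to_colim_at /= /lim_proj /=.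
by rewrite yq0 linear0 [LHS]linear0.
Qed.

End DirectSumLimit.

(** * Coordinates in interval modules *)

Section IntervalModule.
Context {k : fieldType} {d : Order.disp_t} {P : porderType d}.
Variable R : Int P.
Local Notation kR := (kint (k := k) R).

(** The row has length 1 or 0, so summing its entries reads off its coordinate without a case
    distinction, with value 0 outside [R]. *)
Definition kint_coord (p : P) (v : kR p) : k := \sum_i (v : 'rV_(p \in (R : set P))) 0 i.

Definition kint_one (p : P) : kR p := const_mx 1 : 'rV_(p \in (R : set P)).

Lemma kint_coord_linear p : scalar (@kint_coord p).
Proof.
move=> a u v; rewrite /kint_coord mulr_sumr -big_split.
by apply: eq_bigr => i _; rewrite !mxE.
Qed.

Lemma kint_coord0 p : kint_coord (0 : kR p) = 0.
Proof. by rewrite /kint_coord big1 // => i _; rewrite mxE. Qed.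

Lemma kint_coord_one p : int_set R p -> kint_coord (kint_one p) = 1.
Proof.
move=> /mem_set Rp; rewrite /kint_coord /kint_one; under eq_bigr do rewrite mxE.
by rewrite Rp big_ord1.
Qed.

Lemma kint_coordK p (v : kR p) : kint_coord v *: kint_one p = v.
Proof.
move: v; rewrite /kint_one /kint_coord /= /kint_obj; case: (p \in _) => v /=.
  by apply/rowP => i; rewrite !mxE big_ord1 [i]ord1 mulr1.
by rewrite [LHS]thinmx0 [RHS]thinmx0.
Qed.

Lemma kint_eq0 p (v : kR p) : ~ int_set R p -> v = 0.
Proof.
move=> Rp; move: v; rewrite /= /kint_obj memNset // => v.
exact: thinmx0.
Qed.

Lemma kint_map_one p q (pq : (p <= q)%O) : int_set R p -> int_set R q ->
  pm_map kR pq (kint_one p) = kint_one q.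
Proof.
move=> /mem_set Rp /mem_set Rq; rewrite /= lfunE /= /kint_one.
apply/rowP => i; rewrite Rp Rq in i *.
by rewrite pid_mx_1 mulmx1 !mxE.
Qed.

Lemma kint_coord_map p q (pq : (p <= q)%O) (v : kR p) : int_set R p -> int_set R q ->
  kint_coord (pm_map kR pq v) = kint_coord v.
Proof.
move=> Rp Rq.
have -> : pm_map kR pq v = kint_coord v *: kint_one q + 0.
  by rewrite addr0 -[in LHS](kint_coordK v) linearZ -(kint_map_one pq Rp Rq).
rewrite kint_coord_linear kint_coord_one // mulr1.
by rewrite kint_coord0 addr0.
Qed.

Fact kint_lim_subproof (I : Int P) : I `<=` R ->
  ((fun q => kint_one (val q)) : dprod (pm_obj (Defs.restrict kR I))) \in
    lim_pred (M := Defs.restrict kR I).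
Proof.
move=> IR; apply/asboolP => p q pq.
by apply: kint_map_one; apply: IR; apply: set_mem; apply: sp_valP.
Qed.

Definition kint_lim (I : Int P) (IR : I `<=` R) : plim (Defs.restrict kR I) :=
  PLim (kint_lim_subproof IR).

End IntervalModule.

(** * Generalized rank of a direct sum of interval modules *)

Section MultisetRank.
Context {k : fieldType} {d : Order.disp_t} {P : porderType d}.
Variables (m : pf_multiset P) (I : Int P).

Lemma mult_index_finite (p : P) : finite_set [set j : mult_index m | int_set (tag j) p].
Proof.
apply: sub_finite_set (kmult_finite k m p) => j /= jp; exists (kint_one _ p).
apply/eqP => one0; have := kint_coord_one (k := k) jp; rewrite one0 kint_coord0.
by move/eqP; rewrite eq_sym oner_eq0.
Qed.

Lemma mult_index_sup_finite : finite_set [set j : mult_index m | I `<=` tag j].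
Proof.
apply: sub_finite_set (mult_index_finite (val (int_base I))) => j; apply.
exact/set_mem/sp_valP.
Qed.

Let E := fset_set [set j : mult_index m | I `<=` tag j].

Let subE (t : E) : I `<=` tag (val t).
Proof. by have := valP t; rewrite in_fset_set ?inE //; apply: mult_index_sup_finite. Qed.

Lemma gri_kmult_card : gri (kmult k m) I = #|{: E}|.
Proof.
have Ibase : int_set I (val (int_base I)) by apply/set_mem/sp_valP.
set F := Defs.restrict (kmult k m) I.
pose f := lim_to_colim_at F (int_base I).
(* One limit element per summand whose interval contains [I]: constantly 1 in that summand, 0 in the
   others. *)
pose e (t : E) : plim F := lim_in (kmult_finite k m) (kint_lim (k := k) (@subE t)).
apply: (lin_rank_card (b := fun t => f (e t))) => [t|c c0 t|u]; first by exists (e t).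
  (* Independence: the coordinate in summand [t] is compatible along [I], since [I] lies in the
     interval of [t]. It takes the value 1 on [e t] and 0 on the other [e s]. *)
  pose phi (q : subposet I) (v : F q) := kint_coord ((v : dsum _) (val t)).
  have phi_lin q : scalar (@phi q) by move=> a u v; apply: kint_coord_linear.
  have phi_map p q (pq : (p <= q)%O) v : @phi q (pm_map F pq v) = phi p v.
    rewrite /phi [pm_map F pq v]pm_dsum_mapE; apply: kint_coord_map; apply: subE.
      exact/set_mem/(sp_valP p).
    exact/set_mem/(sp_valP q).
  pose L := GRing.isLinear.Build k (F (int_base I)) k _ (@phi _) (phi_lin _).
  pose phiL : {scalar F (int_base I)} := HB.pack (@phi (int_base I)) L.
  move: c0; under eq_bigr do rewrite -linearZ; rewrite -linear_sum.
  move=> /(colim_inj_eq0 phi_lin phi_map).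
  rewrite /lim_proj -[phi _ _]/(phiL (lim_proj _ _)) !linear_sum (bigD1 t) //.
  have phi_e s : phi (int_base I) (val (e s) (int_base I)) = (t == s)%:R.
    rewrite /phi /=; have [<-|ts] := eqVneq t s.
      by rewrite eqtype.dfwith_in kint_coord_one //; apply: subE.
    by rewrite eqtype.dfwith_out ?kint_coord0 // (inj_eq val_inj) eq_sym.
  have eval (s : E) : phiL (lim_proj (int_base I) (c s *: e s)) = c s * (t == s)%:R.
    by rewrite linearZ -phi_e.
  rewrite eval eqxx mulr1 big1 => [|s st]; first by rewrite /= addr0.
  by rewrite [LHS]eval eq_sym (negPf st) mulr0.
(* Generation: [D] collects the finitely many summands that are nonzero at the base point; it
   contains [E], possibly strictly. *)
pose D := fset_set [set j : mult_index m | int_set (tag j) (val (int_base I))].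
have finD := mult_index_finite (val (int_base I)).
have finE := mult_index_sup_finite.
exists (fun t => kint_coord ((u (int_base I) : dsum _) (val t))).
rewrite (lim_to_colim_dsum (D := D)); last first.
  move=> j uj; rewrite in_fset_set // inE; apply: contrapT => jp.
  by move/eqP: uj; apply; apply: kint_eq0.
rewrite -(big_fset_incl _ (A := E)) => [||j jD jE]; first 1 last.
- apply/fsubsetP => j; rewrite !in_fset_set // !inE => jI; exact: jI.
(* A summand in [D] but not in [E] misses some [q] in [I], and its component is zero there. *)
- have [q [Iq jq]] : exists q, int_set I q /\ ~ int_set (tag j) q.
    apply: contrapT => nq; move: jE; rewrite in_fset_set // => /negP; apply.
    by rewrite inE => q Iq; apply: contrapT => jq; apply: nq; exists q.
  apply: (@lim_in_vanish _ _ _ _ _ _ _ _ _ (SubPoset (mem_set Iq))).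
  exact: kint_eq0.
rewrite big_seq_fsetE; apply: eq_bigr => t _.
(* Only the value at the base point matters, and there the component is its coordinate times the
   generator. *)
rewrite -linearZ; congr (colim_inj _).
by rewrite /lim_proj [RHS]linearZ /= -linearZ /= kint_coordK.
Qed.

Lemma gri_kmult :
  (gri (kmult k m) I)%:Z = \sum_(J \in [set J : Int P | I `<=` J]) (m J)%:Z.
Proof.
have finA : finite_set [set J : Int P | I `<=` J /\ m J != 0%N].
  apply: sub_finite_set (mult_finite m (val (int_base I))) => J /= [IJ mJ].
  by split=> //; apply: IJ; apply/set_mem/sp_valP.
set A := fset_set [set J : Int P | I `<=` J /\ m J != 0%N] in finA *.
(* Pairs of an interval in [A] and a copy number; [g] matches them with [E], so [E] can be counted
   interval by interval. *)
pose T : finType := {J : A & 'I_(m (val J))}.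
pose g (t : T) : mult_index m := Tagged (fun J => 'I_(m J)) (tagged t).
have g_inj : injective g.
  move=> [J i] [J' i'] gE; have JJ' : J = J' by apply: val_inj; apply: (congr1 tag gE).
  case: _ / JJ' in i' gE *; congr existT.
  by move/eqP: gE; rewrite eq_Tagged => /eqP.
have EE : E = [fset g t | t in T]%fset.
  have memE j : j \in E <-> I `<=` tag j.
    rewrite in_fset_set; last exact: mult_index_sup_finite.
    by split=> [/set_mem|/mem_set].
  apply/fsetP => j; apply/idP/imfsetP => [/memE|[t _ ->]]; last first.
    by apply/memE => /=; have := valP (tag t); rewrite in_fset_set // inE => -[].
  case: j => J i IJ; have JA : J \in A.
    by rewrite in_fset_set // inE; split=> //; rewrite -lt0n (leq_ltn_trans _ (ltn_ord i)).
  by exists (Tagged (fun J : A => 'I_(m (val J))) (i : 'I_(m (val [` JA]%fset)))).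
rewrite gri_kmult_card -cardfE EE card_imfset //=.
rewrite -cardE card_tagged sumnE big_map big_enum.
transitivity (\sum_(J <- A) m J)%N%:Z.
  by rewrite big_seq_fsetE; congr Posz; apply: eq_bigr => J _; rewrite card_ord.
rewrite (big_morph _ PoszD (erefl 0%:Z)) -fsbig_finite //.
apply: fsbig_widen => [J []//|J [IJ nIJ]] /=.
by apply/eqP/negPn/negP => mJ; apply: nIJ.
Qed.

End MultisetRank.

(** * Domains and rank decompositions read off the Möbius inverse *)

Section Decompositions.
Context {k : fieldType} {d : Order.disp_t} {P : porderType d}.
Variable M : pmodule k P.
Implicit Types (R S : pf_multiset P) (X Y : set (Int P)) (g : Int P -> int).

Local Notation rk := (fun I : Int P => (gri M I)%:Z).

(** Extending by zero turns a function on [X] into one on all intervals, so the choice of [X] only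
    constrains the support of the Möbius inverse. *)
Lemma mobius_invertible_overP X : mobius_invertible_over M X <->
  exists2 g, mobius_inverse rk g & forall J, g J != 0 -> X J.
Proof.
have sumX g I : (forall J, g J != 0 -> X J) ->
    \sum_(J \in [set J : X | I `<=` val J]) g (val J) =
    \sum_(J \in [set J : Int P | I `<=` J]) g J.
  move=> gX.
  have bij : set_bij [set J : X | I `<=` val J]
      [set J : Int P | I `<=` J /\ X J] val.
    split=> [J IJ|J K _ _ /val_inj //|J [IJ XJ]].
      by split=> //; apply: set_valP.
    by exists (SigSub (mem_set XJ)).
  rewrite -(reindex_fsbig _ _ _ g bij); apply: fsbig_widen => [J []//|J [IJ nIX]] /=.
  by apply/eqP/negPn/negP => /gX XJ; apply: nIX.
split=> [[dX hX]|[g hg gX]].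
  pose g J := if insub J is Some x then dX x else 0.
  have gv (x : X) : g (val x) = dX x by rewrite /g valK.
  have gX J : g J != 0 -> X J.
    by rewrite /g; case: insubP => [x /set_mem XJ _ _ //|_]; rewrite eqxx.
  exists g => // I; have [fin ->] := hX I; split.
    apply: sub_finite_set (finite_image val fin) => J /= [IJ nz].
    by exists (SigSub (mem_set (gX _ nz))); rewrite //= -gv.
  by rewrite -sumX //; apply: eq_fsbigr => J _; rewrite gv.
exists (g \o val) => I; have [fin ->] := hg I; split; last by rewrite /= sumX.
by apply: (finite_preimage _ fin) => J K _ _ /val_inj.
Qed.

(** By uniqueness every domain contains the support of [g], and this support is itself a domain,
    hence the least one. *)
Lemma minimal_mobius_domainP X g : mobius_inverse rk g ->
  minimal_mobius_domain M X <-> X = [set J | g J != 0].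
Proof.
move=> hg.
have over Y : mobius_invertible_over M Y -> [set J | g J != 0] `<=` Y.
  by move=> /mobius_invertible_overP[g' /(mobius_inverse_uniq hg) <-].
have overg : mobius_invertible_over M [set J | g J != 0].
  by apply/mobius_invertible_overP; exists g.
split=> [[hX minX]|->]; first by apply/esym/minX => //; apply: over.
by split=> // Y Yg /over gY; apply/seteqP.
Qed.

Lemma mobius_inverse_mult R : mobius_inverse (fun I => (gri (kmult k R) I)%:Z) (fun J => (R J)%:Z).
Proof.
move=> I; split; last exact: gri_kmult.
apply: sub_finite_set (mult_finite R (sp_val (int_base I))) => J /= [IJ RJ].
by split=> //; apply: IJ; apply: set_mem; apply: sp_valP.
Qed.

Lemma rank_decompositionP R S : rank_decomposition M (R, S) <->
  mobius_inverse rk (fun J => (R J)%:Z - (S J)%:Z).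
Proof.
have := mobius_inverseB (mobius_inverse_mult R) (mobius_inverse_mult S).
by split=> h I; [rewrite h|have [_ ->] := h I; have [_ ->] := H I].
Qed.

(** Uniqueness forces the difference of the multiplicities to be [g], and disjointness then forces
    the signed parts. *)
Lemma minimal_rank_decompositionP R S g : mobius_inverse rk g ->
  minimal_rank_decomposition M (R, S) <->
  (forall J, R J = posz_part (g J) /\ S J = posz_part (- g J)).
Proof.
move=> hg; split=> [[/rank_decompositionP/(mobius_inverse_uniq hg) -> disj] J|RS].
  split; first by rewrite posz_part_disjB.
  by rewrite opprB posz_part_disjB //; case: (disj J); [right|left].
split=> [|J] /=; last by have [-> ->] := RS J; apply: posz_part_disj.
apply/rank_decompositionP; congr mobius_inverse: hg; apply/funext => J.
by have [-> ->] := RS J; rewrite posz_partB.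
Qed.

End Decompositions.

Theorem theorem1 (k : fieldType) (d : Order.disp_t) (P : porderType d)
    (M : pmodule k P) :
  [<-> mobius_invertible M;
       exists RS : pf_multiset P * pf_multiset P, rank_decomposition M RS;
       exists! RS : pf_multiset P * pf_multiset P, minimal_rank_decomposition M RS;
       exists! X : set (Int P), minimal_mobius_domain M X;
       exists! dM : Int P -> int, forall I : Int P,
         finite_set [set J : Int P | I `<=` J /\ dM J != 0] /\
         (gri M I)%:Z = \sum_(J \in [set J : Int P | I `<=` J]) dM J].
Proof.
(* Used twice: the signed parts of a Möbius inverse give both the existence in (ii) and the unique
   minimal decomposition in (iii). *)
have minimal g : mobius_inverse (fun I => (gri M I)%:Z) g ->
    exists! RS : pf_multiset P * pf_multiset P, minimal_rank_decomposition M RS.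
  move=> hg.
  pose R := PfMultiset (fun p => @pf_comp_finite _ _ _ _ posz_part p erefl hg).
  pose S := PfMultiset (fun p => @pf_comp_finite _ _ _ _ (posz_part \o -%R) p erefl hg).
  exists (R, S); split=> [|[R' S']].
    exact/(minimal_rank_decompositionP _ _ hg).
  move=> /(minimal_rank_decompositionP _ _ hg) RS.
  by congr pair; apply: pf_multiset_eq => J; have [RJ SJ] := RS J; rewrite /= ?RJ ?SJ.
tfae.
- by move=> [X /mobius_invertible_overP[g /minimal[RS [[RSdec _] _]] _]]; exists RS.
- by move=> [[R S] /rank_decompositionP/minimal].
- move=> [[R S] [[/rank_decompositionP hg _] _]].
  exists [set J | (R J)%:Z - (S J)%:Z != 0].
  split; first exact/(minimal_mobius_domainP _ hg).
  by move=> X /(minimal_mobius_domainP _ hg) ->.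
- move=> [X [[/mobius_invertible_overP[g hg _] _] _]].
  by exists g; split=> // g'; apply: mobius_inverse_uniq.
(* The domain of all intervals puts no constraint on the support of [g]. *)
- move=> [g [hg _]]; exists setT; apply/mobius_invertible_overP.
  by exists g.
Qed.
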